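(* Let $\alpha\ge1$, let $(\mathcal{Y},\|\cdot\|)$ be a normed space and let $Y_1,\dots,Y_n$ be independent $\mathcal{Y}$-valued random variables. Set $$K=\max_{i\in[n]}\big\|\,\|Y_i\|\,\big\|_{\psi_\alpha},\qquad U^2=\sum_{i\in[n]}\big\|\,\|Y_i\|\,\big\|_{\psi_\alpha}^2,\qquad\sigma^2=\sum_{i\in[n]}\mathbb{E}\|Y_i\|^2,\qquad z=\left(4\,\underline{\log}\frac{eU}{\sigma}\right)^{1/\alpha},$$ with $K$ finite and $\sigma>0$, and let $f(y)=\frac12\left\|\sum_{i}y_i\right\|$ for $y\in\mathcal{Y}^n$, $Y=(Y_1,\dots,Y_n)$. Then for any $\mathrm{x}>0$, with probability at least $1-e^{-\mathrm{x}}$, $$f(Y)-\mathbb{E}f(Y)\le\sigma\sqrt{2\mathrm{x}\frac{n+1}{n}}+\frac{4Kz\,\mathrm{x}}{\min\left\{2\alpha z^\alpha,\ \underline{\log}\left(\left(\frac{Kz}{\sigma\frac{n+1}{n}}\right)^2\mathrm{x}\right)\right\}},$$ and, with probability at least $1-e^{-\mathrm{x}}$, $$f(Y)-\mathbb{E}f(Y)\le\sigma\sqrt{2\mathrm{x}\frac{n+1}{n}}+\frac34Kz\,\mathrm{x}\,\frac{n+1}{n}.$$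
   Context: $[n]=\{1,\dots,n\}$, $\underline{\log}\,x=\max(\ln x,1)$. With $\psi_\alpha(x)=e^{x^\alpha}-1$ ($x\ge0$), the Orlicz norm of a real random variable $X$ is $\|X\|_{\psi_\alpha}=\inf\{t>0:\mathbb{E}\,\psi_\alpha(|X|/t)\le1\}$. The space $\mathcal{Y}$ carries a $\sigma$-algebra for which $f$ and the norm are measurable. *)

(* Defs.v *)
From HB Require Import structures.
From mathcomp Require Import all_boot all_order all_algebra.
From mathcomp Require Import all_classical all_reals all_analysis.

Set Implicit Arguments.
Unset Strict Implicit.
Unset Printing Implicit Defensive.

Import Order.TTheory GRing.Theory Num.Theory.
Import numFieldNormedType.Exports.

Local Open Scope classical_set_scope.
Local Open Scope ring_scope.

(* No compatibility between the norm and the sigma-algebra is built in: the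
   sigma-algebra need not be the Borel one. *)
#[short(type="measurableNormedModType")]
HB.structure Definition MeasurableNormedModule (d : measure_display)
    (R : realType) :=
  {E of NormedModule R E & Measurable d E}.

Definition logbar (R : realType) (x : R) : R := Num.max (ln x) 1.

(* Used only at x >= 0. *)
Definition psi (R : realType) (alpha x : R) : R := expR (x `^ alpha) - 1.

(* The infimum is taken in \bar R, so it is +oo when no t > 0 qualifies. *)
Definition orlicz_norm (d : measure_display) (T : measurableType d)
    (R : realType) (P : probability T R) (alpha : R) (X : T -> R) : \bar R :=
  ereal_inf [set t%:E | t in [set t : R | 0 < t /\
    ('E_P[fun w => psi alpha (`|X w| / t)%R] <= 1)%E]].

Definition mutually_independent (d dE : measure_display)
    (T : measurableType d) (R : realType) (P : probability T R)
    (E : measurableType dE) (n : nat) (Y : 'I_n -> {RV P >-> E}) : Prop :=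
  forall (J : {set 'I_n}) (A : 'I_n -> set E),
    (forall i, measurable (A i)) ->
    P (\bigcap_(i in [set` J]) (Y i @^-1` A i)) =
    (\prod_(i in J) P (Y i @^-1` A i))%E.

Section parameters.
Context (d dE : measure_display) (T : measurableType d) (R : realType).
Context (P : probability T R) (E : measurableNormedModType dE R).
Context (n : nat) (alpha : R) (Y : 'I_n -> {RV P >-> E}).

Definition psi_norm (i : 'I_n) : \bar R :=
  orlicz_norm P alpha (fun w => `|Y i w|).

Definition max_psi_norm : \bar R := (\big[maxe/-oo]_(i < n) psi_norm i)%E.

Definition l2_psi_norm : \bar R := sqrte (\sum_(i < n) psi_norm i ^+ 2)%E.

Definition l2_norm : \bar R :=
  sqrte (\sum_(i < n) 'E_P[fun w => (`|Y i w| ^+ 2)%R])%E.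

End parameters.

Definition half_norm_sum (dE : measure_display) (R : realType)
    (E : measurableNormedModType dE R) (n : nat) (y : n.-tuple E) : R :=
  2^-1 * `|\sum_(i < n) tnth y i|.

(* Main.v *)
Require Import Defs.
From HB Require Import structures.
From mathcomp Require Import all_boot all_order all_algebra.
From mathcomp Require Import all_classical all_reals all_analysis.
From mathcomp Require Import measurable_realfun ring lra.

Set Implicit Arguments.
Unset Strict Implicit.
Unset Printing Implicit Defensive.

Import Order.TTheory GRing.Theory Num.Theory.
Import numFieldNormedType.Exports.

Local Open Scope classical_set_scope.
Local Open Scope ring_scope.

(* Changing one argument [y_i] into [y_i'] moves [f] by at most
   [(|y_i| + |y_i'|) / 2], so integrating out the coordinates one at a time and
   symmetrizing each of them gives
     E exp(l (f(Y) - E f(Y))) <= prod_i E cosh(l |Y_i|)   for l >= 0.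
   With [a = l K z] and [4 L = z^alpha], the part of [|Y_i|] below its [z]-fold
   Orlicz norm contributes at most [l^2/2 E|Y_i|^2 (1 + O(a e^a))]; the part
   above is controlled by [E exp((|Y_i|/k_i)^alpha) <= 2], and gains a factor
   [exp(-4 L) <= (sigma/(eU))^4], which turns [sum_i k_i^2 = U^2] back into
   [sigma^2].  Hence the log-Laplace transform is at most
   [l^2 sigma^2/2 (1 + theta a e^a)] and both inequalities follow from
   Chernoff's bound: for the second one the transform is sub-gamma with scale
   [3 K z / 4], and for the first one [l = m / (3 K z)], with [m] the minimum
   in the denominator, when [m > 16/3] (otherwise it follows from the second).
   As [(n+1)/n >= 1], both bounds may be proved with this factor replaced by 1. *)

(** * Symmetrization *)

Definition cosh (R : realType) (x : R) : R := (expR x + expR (- x)) / 2.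

Section cosh.
Context (R : realType).
Implicit Types x y : R.

Lemma cosh_ge1 x : 1 <= cosh x.
Proof.
rewrite /cosh ler_pdivlMr// mul1r.
have := expR_ge1Dx x; have := expR_ge1Dx (- x); lra.
Qed.

Lemma cosh_ge0 x : 0 <= cosh x.
Proof. exact: le_trans ler01 (cosh_ge1 x). Qed.

Lemma measurable_cosh : measurable_fun [set: R] (@cosh R).
Proof.
rewrite /cosh; apply: measurable_funM => //; apply: measurable_funD => //.
apply: measurableT_comp => //.
Qed.

Lemma expR_midpoint x y : 2 * expR ((x + y) / 2) <= expR x + expR y.
Proof.
have -> : (x + y) / 2 = x / 2 + y / 2 by lra.
have ex (t : R) : expR t = expR (t / 2) * expR (t / 2) by rewrite -expRD -splitr.
rewrite expRD (ex x) (ex y).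
have := sqr_ge0 (expR (x / 2) - expR (y / 2)); nra.
Qed.

Lemma le_expRDN x y : `|x| <= y -> expR x + expR (- x) <= expR y + expR (- y).
Proof.
wlog x0 : x / 0 <= x => [h|].
  have [/h//|/ltW x0] := leP 0 x; rewrite -normrN => xy.
  by have := h (- x); rewrite opprK addrC; apply => //; rewrite oppr_ge0.
rewrite ger0_norm// => xy.
have e1 := expR_gt0 x; have := expR_gt0 y.
have xy' : expR x <= expR y by rewrite ler_expR.
have e2 : 1 <= expR x by rewrite -expR0 ler_expR.
rewrite !expRN.
set u := expR x in e1 xy' e2 *; set v := expR y in xy' *.
move=> v0.
rewrite -subr_ge0.
have -> : v + v^-1 - (u + u^-1) = (v - u) * (u * v - 1) / (u * v).
  by field; rewrite !gt_eqF.
rewrite divr_ge0 ?mulr_ge0 ?subr_ge0//; [nra|exact: ltW|exact: ltW].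
Qed.

(** The left side is [2 cosh (l (x - x'))]. Since [cosh] grows with the absolute value of its
    argument, [x - x'] may be replaced by the midpoint of [v] and [v']; convexity then separates
    these two. *)
Lemma expR_cross_le_cosh (l x x' v v' : R) : 0 <= l ->
  `|x - x'| <= (v + v') / 2 ->
  expR (l * x) * expR (- (l * x')) + expR (- (l * x)) * expR (l * x')
    <= cosh (l * v) + cosh (l * v').
Proof.
move=> l0 xv; rewrite -!expRD.
have -> : - (l * x) + l * x' = - (l * x - l * x') by lra.
apply: (@le_trans _ _ (expR ((l * v + l * v') / 2) +
                       expR (- ((l * v + l * v') / 2)))).
  apply: le_expRDN; rewrite -mulrBr normrM ger0_norm//.
  by rewrite -mulrDr -mulrA ler_wpM2l.
have := expR_midpoint (l * v) (l * v').
have := expR_midpoint (- (l * v)) (- (l * v')).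
have -> : (- (l * v) - (l * v')) / 2 = - ((l * v + l * v') / 2) by lra.
rewrite /cosh; lra.
Qed.

End cosh.

Section symmetrization.
Context d (T : measurableType d) (R : realType) (P : probability T R).
Local Open Scope ereal_scope.

Lemma expR_expectation_le (X : T -> R) :
  P.-integrable [set: T] (EFin \o X) ->
  (expR (fine (\int[P]_w (X w)%:E)))%:E <= \int[P]_w (expR (X w))%:E.
Proof.
move=> iX; have mX : measurable_fun setT X.
  by apply/measurable_EFinP; exact: measurable_int iX.
have Xfin := integrable_fin_num measurableT iX.
set m := fine _.
have mexp : measurable_fun setT (fun w => (expR (X w))%:E).
  by apply/measurable_EFinP; exact: measurableT_comp.
have [->|fin] := eqVneq (\int[P]_w (expR (X w))%:E) +oo; first exact: leey.
have iexp : P.-integrable setT (fun w => (expR (X w))%:E).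
  apply/integrableP; split => //.
  under eq_integral do rewrite gee0_abs ?lee_fin ?expR_ge0//.
  by rewrite ltey.
(* The tangent of [expR] at the mean [m] lies below [expR], and its expectation is [expR m]. *)
have -> : (expR m)%:E =
    \int[P]_w ((expR m)%:E * ((X w)%:E + (1 - m)%:E)).
  rewrite integralZl//; last first.
    apply: integrableD => //.
    exact: finite_measure_integrable_cst.
  rewrite integralD//; last exact: finite_measure_integrable_cst.
  rewrite integral_cst//= probability_setT mule1 -(fineK Xfin) -/m.
  rewrite -EFinD -EFinM; congr EFin; lra.
apply: le_integral => //.
- apply: integrableZl => //; apply: integrableD => //.
  exact: finite_measure_integrable_cst.
- move=> w _; rewrite -EFinD -EFinM lee_fin.
  have -> : X w = (m + (X w - m))%R by lra.
  rewrite expRD ler_wpM2l ?expR_ge0//.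
  have := expR_ge1Dx (X w - m); lra.
Qed.

(* Jensen's inequality [exp(- l E X) <= E exp(- l X)] introduces an independent
   copy [X'] of [X]; the law of [X - X'] being symmetric, [exp] becomes [cosh],
   and convexity of [cosh] separates [V] from its copy. *)
Lemma mgf_le_cosh (X V : T -> R) (l : R) : (0 <= l)%R ->
  P.-integrable [set: T] (EFin \o X) -> measurable_fun [set: T] V ->
  (forall w w', `|X w - X w'| <= (V w + V w') / 2)%R ->
  \int[P]_w (expR (l * X w))%:E <=
    (expR (l * fine (\int[P]_w (X w)%:E)))%:E * \int[P]_w (cosh (l * V w))%:E.
Proof.
move=> l0 iX mV XV; have mX : measurable_fun setT X.
  by apply/measurable_EFinP; exact: measurable_int iX.
have Xfin := integrable_fin_num measurableT iX.
set m := fine _.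
have mp : measurable_fun setT (fun w => (expR (l * X w))%:E).
  apply/measurable_EFinP; apply: measurableT_comp => //.
  exact: measurable_funM.
have mn : measurable_fun setT (fun w => (expR (- (l * X w)))%:E).
  apply/measurable_EFinP; apply: measurableT_comp => //.
  by apply: measurableT_comp => //; exact: measurable_funM.
have mc : measurable_fun setT (fun w => (cosh (l * V w))%:E).
  apply/measurable_EFinP; apply: measurableT_comp; first exact: measurable_cosh.
  exact: measurable_funM.
set A := \int[P]_w _; set C := \int[P]_w (cosh _)%:E.
pose B := \int[P]_w (expR (- (l * X w)))%:E.
have A0 : 0 <= A by apply: integral_ge0 => w _; rewrite lee_fin expR_ge0.
have B0 : 0 <= B by apply: integral_ge0 => w _; rewrite lee_fin expR_ge0.
have C0 : 0 <= C by apply: integral_ge0 => w _; rewrite lee_fin cosh_ge0.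
(* Iterated integrals against [P] play the role of the independent copy: here over [w'] with [w]
   fixed, then over [w] in [outer]. *)
have inner w : (expR (l * X w))%:E * B + (expR (- (l * X w)))%:E * A <=
    (cosh (l * V w))%:E + C.
  rewrite -ge0_integralZl//.
  rewrite -ge0_integralZl//.
  rewrite -ge0_integralD//; [|exact: measurable_funeM..].
  have -> : (cosh (l * V w))%:E + C =
      \int[P]_w' ((cosh (l * V w))%:E + (cosh (l * V w'))%:E).
    rewrite ge0_integralD//; [|by move=> *; rewrite lee_fin cosh_ge0..].
    by rewrite integral_cst//= probability_setT mule1.
  apply: ge0_le_integral => //.
  - by move=> *; rewrite adde_ge0// mule_ge0// lee_fin expR_ge0.
  - by apply: emeasurable_funD; exact: measurable_funeM.
  - exact: emeasurable_funD.
  - by move=> w' _; rewrite -!EFinM -!EFinD lee_fin expR_cross_le_cosh.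
have outer : A * B + A * B <= C + C.
  have -> : A * B + A * B =
      \int[P]_w ((expR (l * X w))%:E * B + (expR (- (l * X w)))%:E * A).
    rewrite ge0_integralD//; last 4 first.
    - by move=> *; rewrite mule_ge0// lee_fin expR_ge0.
    - exact: emeasurable_funM.
    - by move=> *; rewrite mule_ge0// lee_fin expR_ge0.
    - exact: emeasurable_funM.
    congr (_ + _); first exact/esym/ge0_integralZr.
    by rewrite muleC; exact/esym/ge0_integralZr.
  have -> : C + C = \int[P]_w ((cosh (l * V w))%:E + C).
    rewrite ge0_integralD//; last by move=> *; rewrite lee_fin cosh_ge0.
    by rewrite integral_cst//= probability_setT mule1.
  apply: ge0_le_integral => //.
  - by move=> *; rewrite adde_ge0// mule_ge0// lee_fin expR_ge0.
  - by apply: emeasurable_funD; exact: emeasurable_funM.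
  - exact: emeasurable_funD.
have ABC : A * B <= C.
  (* Halving [outer] in the extended reals requires finite values; if [C] is finite, so is
     [A * B]. *)
  have [->|Coo] := eqVneq C +oo; first exact: leey.
  have Cfin : C \is a fin_num by rewrite ge0_fin_numE// ltey.
  have ABfin : A * B \is a fin_num.
    rewrite ge0_fin_numE ?mule_ge0//; apply: (@le_lt_trans _ _ (C + C)).
      by apply: le_trans outer; rewrite leeDl ?mule_ge0.
    by rewrite lte_add_pinfty// ltey.
  move: outer; rewrite -(fineK Cfin) -(fineK ABfin) -!EFinD !lee_fin; lra.
have Bm : (expR (- (l * m)))%:E <= B.
  have := @expR_expectation_le (fun w => (- (l * X w))%R).
  have -> : \int[P]_w (- (l * X w))%:E = (- (l * m))%:E.
    rewrite -mulNr; under eq_integral do rewrite -mulNr EFinM.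
    by rewrite integralZl// -(fineK Xfin).
  apply; rewrite (_ : _ \o _ = (fun w => (- l)%:E * (X w)%:E)); last first.
    by apply/funext => w /=; rewrite -mulNr.
  exact: integrableZl.
apply: (@le_trans _ _ ((expR (l * m))%:E * (A * B))); last first.
  by apply: lee_wpmul2l => //; rewrite lee_fin expR_ge0.
(* By Jensen, [expR (l * m) * B] is at least 1, so inserting it only increases [A]. *)
rewrite muleCA -[leLHS]mule1 lee_wpmul2l//.
apply: (@le_trans _ _ ((expR (l * m))%:E * (expR (- (l * m)))%:E)).
  by rewrite -EFinM -expRD subrr expR0.
by apply: lee_wpmul2l => //; rewrite lee_fin expR_ge0.
Qed.

End symmetrization.

(** * Independence of the first coordinate from the others *)

(** Under the law of [X] the integral becomes a Tonelli marginal, whose measurability is known. *)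
Lemma measurable_fun_ge0_integral_section d d1 d2 (T : measurableType d)
    (T1 : measurableType d1) (T2 : measurableType d2) (R : realType)
    (P : probability T R) (X : {RV P >-> T2}) (G : T1 * T2 -> \bar R) :
  measurable_fun [set: T1 * T2] G -> (forall p, 0 <= G p)%E ->
  measurable_fun [set: T1] (fun y => \int[P]_w G (y, X w))%E.
Proof.
move=> mG G0; rewrite (_ : (fun _ => _) = fubini_F (distribution P X) G).
  exact: measurable_fun_fubini_tonelli_F.
apply/funext => y; rewrite /fubini_F ge0_integral_distribution//.
exact: measurableT_comp.
Qed.

Section independent_pair.
Context d d1 d2 (T : measurableType d) (T1 : measurableType d1)
  (T2 : measurableType d2) (R : realType) (P : probability T R).
Variables (X : {RV P >-> T1}) (X' : {RV P >-> T2}).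
Hypothesis XX' : forall A B, measurable A -> measurable B ->
  P (X @^-1` A `&` X' @^-1` B) = (P (X @^-1` A) * P (X' @^-1` B))%E.
Local Open Scope ereal_scope.

Let XX'w (w : T) : T1 * T2 := (X w, X' w).

Let mXX' : measurable_fun [set: T] XX'w.
Proof. exact: measurable_fun_pair. Qed.

HB.instance Definition _ := isMeasurableFun.Build _ _ _ _ XX'w mXX'.

(** Independence says that the joint law is the product on rectangles, which determines it. *)
Let distr_pair A : measurable A ->
  (distribution P X \x distribution P X') A = distribution P XX'w A.
Proof.
by move=> mA; exact: product_measure_unique.
Qed.

Let integral_prodE (f : T1 * T2 -> \bar R) :
  \int[distribution P X \x distribution P X']_p f p =
  \int[distribution P XX'w]_p f p.
Proof. exact: (eq_measure_integral _ (fun A mA _ => distr_pair mA)). Qed.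

Variable G : T1 * T2 -> \bar R.
Hypothesis mG : measurable_fun [set: T1 * T2] G.

Lemma ge0_integral_indep : (forall p, 0 <= G p) ->
  \int[P]_w G (X w, X' w) = \int[P]_w \int[P]_w' G (X w, X' w').
Proof.
move=> G0; transitivity (\int[distribution P XX'w]_p G p).
  by rewrite ge0_integral_distribution.
rewrite -integral_prodE fubini_tonelli1// ge0_integral_distribution//; last 2 first.
- exact: measurable_fun_fubini_tonelli_F.
- by move=> x; exact: integral_ge0.
apply: eq_integral => w _ /=.
rewrite /fubini_F ge0_integral_distribution//.
exact: measurableT_comp.
Qed.

Hypothesis iG : P.-integrable [set: T] (fun w => G (X w, X' w)).
(** Asked at every [y], so that the Fubini marginal and the integral over [P] agree as functions and
    not only almost everywhere. *)
Hypothesis iG2 : forall y, P.-integrable [set: T] (fun w => G (y, X' w)).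

Let iGprod : (distribution P X \x distribution P X').-integrable [set: T1 * T2] G.
Proof.
apply/integrableP; split => //.
rewrite integral_prodE ge0_integral_distribution//; last exact: measurableT_comp.
by move/integrableP : iG => [].
Qed.

Let fubini_indepE : fubini_F (distribution P X') G =
  fun y => \int[P]_w G (y, X' w).
Proof.
apply/funext => y; rewrite /fubini_F integral_distribution//; last exact: iG2.
exact: measurableT_comp.
Qed.

Lemma measurable_fun_integral_indep :
  measurable_fun [set: T1] (fun y => \int[P]_w G (y, X' w)).
Proof.
rewrite -fubini_indepE.
exact: measurable_fubini_F iGprod.
Qed.

Lemma integrable_integral_indep :
  P.-integrable [set: T] (fun w => \int[P]_w' G (X w, X' w')).
Proof.
rewrite -[X in _.-integrable _ X]/((fun y => \int[P]_w' G (y, X' w')) \o X).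
have mF := measurable_fun_integral_indep.
apply/integrableP; split; first exact: measurableT_comp.
have /integrableP[_] := integrable_fubini_F iGprod.
rewrite -/(fubini_F _ _) fubini_indepE.
by rewrite ge0_integral_distribution//; exact: measurableT_comp.
Qed.

Lemma integral_indep :
  \int[P]_w G (X w, X' w) = \int[P]_w \int[P]_w' G (X w, X' w').
Proof.
transitivity (\int[distribution P XX'w]_p G p).
  by rewrite integral_distribution.
rewrite -integral_prodE -integral12_prod_meas1// fubini_indepE.
rewrite integral_distribution//.
- exact: measurable_fun_integral_indep.
- exact: integrable_integral_indep.
Qed.

End independent_pair.

Section independent_tuple.
Context d dE (T : measurableType d) (E : measurableType dE) (R : realType)
  (P : probability T R).

Definition rv_tuple n (Y : 'I_n -> {RV P >-> E}) (w : T) : n.-tuple E :=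
  [tuple Y i w | i < n].

Lemma measurable_rv_tuple n (Y : 'I_n -> {RV P >-> E}) :
  measurable_fun [set: T] (rv_tuple Y).
Proof.
apply/measurable_fun_tnthP => i; rewrite (_ : _ \o _ = Y i)//.
by apply/funext => w /=; rewrite tnth_mktuple.
Qed.

HB.instance Definition _ n Y :=
  isMeasurableFun.Build _ _ _ _ (@rv_tuple n Y) (@measurable_rv_tuple n Y).

Definition box n (A : 'I_n -> set E) : set (n.-tuple E) :=
  \bigcap_i (fun t => tnth t i) @^-1` A i.

Lemma measurable_box n (A : 'I_n -> set E) :
  (forall i, measurable (A i)) -> measurable (box A).
Proof.
move=> mA; apply: fin_bigcap_measurable => [|i _].
  exact: finite_finset.
by rewrite -[X in measurable X]setTI; exact: measurable_tnth.
Qed.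

(** The pi-system generating the product sigma-algebra, on which mutual independence can be applied
    directly. *)
Definition boxes n : set (set (n.-tuple E)) :=
  [set B | exists2 A : 'I_n -> set E, (forall i, measurable (A i)) & B = box A].

Lemma boxesI n : setI_closed (@boxes n).
Proof.
move=> _ _ [A mA ->] [B mB ->]; exists (fun i => A i `&` B i).
  by move=> i; exact: measurableI.
by rewrite /box -bigcapI.
Qed.

Lemma boxesT n : @boxes n [set: n.-tuple E].
Proof.
by exists (fun=> setT) => //; apply/seteqP; split => // t _ i _.
Qed.

Lemma measurable_boxes n : @measurable _ (n.-tuple E) = <<s @boxes n >>.
Proof.
apply/seteqP; split.
- apply: smallest_sub => [|A]; first exact: smallest_sigma_algebra.
  rewrite -bigcup_seq => -[i _ [B mB <-]].
  apply: sub_sigma_algebra; exists (fun j => if j == i then B else setT).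
    by move=> j; case: ifP.
  apply/seteqP; split => [t [_ Bt] j _ /=|t /(_ i I)] /=.
    by case: eqP => // ->.
  by rewrite eqxx.
- apply: smallest_sub; first exact: sigma_algebra_measurable.
  by move=> _ [A mA ->]; exact: measurable_box.
Qed.

Lemma rv_tuple_preimage_box n (Y : 'I_n -> {RV P >-> E}) (A : 'I_n -> set E) :
  rv_tuple Y @^-1` box A = \bigcap_(i in [set` [set: 'I_n]%SET]) (Y i @^-1` A i).
Proof.
apply/seteqP; split => w /= Aw i _.
- by have := Aw i I; rewrite /= tnth_mktuple.
- by rewrite /preimage/= tnth_mktuple; apply: Aw; rewrite /= inE.
Qed.

(** For fixed [A] both sides are finite measures in [B] that agree on boxes, hence everywhere. *)
Lemma indep_head_tail n (Y : 'I_n.+1 -> {RV P >-> E}) :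
  mutually_independent Y -> forall A B, measurable A -> measurable B ->
  P (Y ord0 @^-1` A `&` @rv_tuple n (Y \o lift ord0) @^-1` B) =
  (P (Y ord0 @^-1` A) * P (@rv_tuple n (Y \o lift ord0) @^-1` B))%E.
Proof.
move=> iY A B mA mB.
have mYA : measurable (Y ord0 @^-1` A).
  by rewrite -[X in measurable X]setTI; exact: measurable_funP.
pose X' : {mfun T >-> n.-tuple E} := @rv_tuple n (Y \o lift ord0).
have PAfin : P (Y ord0 @^-1` A) \is a fin_num by exact: fin_num_measure.
have PA0 : 0 <= fine (P (Y ord0 @^-1` A)) by exact: fine_ge0.
pose m1 := pushforward (mrestr P mYA) X'.
pose m2 := mscale (NngNum PA0) (distribution P X').
have <- : m1 B = P (Y ord0 @^-1` A `&` X' @^-1` B).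
  by rewrite /m1 /pushforward /mrestr setIC.
have <- : m2 B = (P (Y ord0 @^-1` A) * P (X' @^-1` B))%E.
  by rewrite /m2 /mscale /distribution /pushforward/= fineK.
apply: (measure_unique (@boxes n) (fun=> setT)) => //.
- exact: measurable_boxes.
- exact: boxesI.
- by move=> _; exact: boxesT.
- by rewrite bigcup_const.
- move=> _ [C mC ->]; transitivity (P (X' @^-1` box C `&` Y ord0 @^-1` A)) => //.
  transitivity (P (Y ord0 @^-1` A) * P (X' @^-1` box C))%E; last first.
    by rewrite -[in LHS](fineK PAfin).
  rewrite rv_tuple_preimage_box.
  (* [D] puts [A] in front of [C]. Independence over all indices gives the joint event, over all but
     [ord0] the tail event; the two products differ by the head factor. *)
  pose D (i : 'I_n.+1) := oapp C A (unlift ord0 i).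
  have mD i : measurable (D i) by rewrite /D; case: unliftP => [j|] _ /=.
  have D0 : D ord0 = A by rewrite /D unlift_none.
  have Dl j : D (lift ord0 j) = C j by rewrite /D liftK.
  have -> : P (Y ord0 @^-1` A) = P (Y ord0 @^-1` D ord0) by rewrite D0.
  have e1 := iY [set: 'I_n.+1]%SET D mD.
  have e2 := iY [set~ ord0]%SET D mD.
  have f1 : \bigcap_(i in [set` [set: 'I_n.+1]%SET]) (Y i @^-1` D i) =
     (\bigcap_(i in [set` [set: 'I_n]%SET]) ((Y \o lift ord0) i @^-1` C i)) `&`
       Y ord0 @^-1` A.
    apply/seteqP; split => w /=.
      move=> h; split => [j _|]; last by rewrite -D0; apply: h; rewrite /= inE.
      by rewrite -Dl; apply: h; rewrite /= inE.
    move=> [h hA] i _; have [j ->|->] := unliftP ord0 i; last by rewrite D0.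
    by rewrite Dl; apply: h; rewrite /= inE.
  have f2 : \bigcap_(i in [set` [set~ ord0]%SET]) (Y i @^-1` D i) =
     \bigcap_(i in [set` [set: 'I_n]%SET]) ((Y \o lift ord0) i @^-1` C i).
    apply/seteqP; split => w /=.
      by move=> h j _; rewrite -Dl; apply: h; rewrite /= in_setC1.
    move=> h i; have [j ->|->] := unliftP ord0 i; last by rewrite /= in_setC1 eqxx.
    by rewrite Dl => _; apply: h; rewrite /= inE.
  rewrite -f1 -f2 e1 e2 (bigD1 ord0)/= ?inE//; congr (_ * _)%E.
  by apply: eq_bigl => i; rewrite !inE.
- move=> _; suff : (P (X' @^-1` setT `&` Y ord0 @^-1` A) < +oo)%E by [].
  by rewrite preimage_setT setTI ltey_eq PAfin.
Qed.

Lemma mutually_independent_lift n (Y : 'I_n.+1 -> {RV P >-> E}) :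
  mutually_independent Y -> mutually_independent (Y \o lift ord0).
Proof.
move=> iY J C mC.
(* The value [setT] at [ord0] is a placeholder: the image of [J] under [lift ord0] avoids this
   index. *)
pose D (i : 'I_n.+1) := oapp C setT (unlift ord0 i).
have mD i : measurable (D i) by rewrite /D; case: unliftP => [j|] _ /=.
have Dl j : D (lift ord0 j) = C j by rewrite /D liftK.
have := iY (lift ord0 @: J) D mD.
rewrite big_imset/=; last by move=> i j _ _; exact: lift_inj.
under [in X in _ = X -> _]eq_bigr do rewrite Dl.
move=> <-; congr (P _); apply/seteqP; split => w /=.
- by move=> h i /imsetP[j jJ ->]; rewrite Dl; exact: h.
- by move=> h j jJ; rewrite -Dl; apply: h; rewrite /= imset_f.
Qed.

End independent_tuple.

(** * Tensorization of the Laplace transform *)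

Section mgf_tensorization.
Context d dE (T : measurableType d) (E : measurableType dE) (R : realType)
  (P : probability T R).
Variables (W : E -> R) (l : R).
Hypothesis mW : measurable_fun [set: E] W.
Hypothesis l0 : 0 <= l.
Local Open Scope ereal_scope.

Lemma integrable_le_sum n (Y : 'I_n -> {RV P >-> E}) (X : T -> R) (C : R) :
  (forall i, P.-integrable [set: T] (fun w => (W (Y i w))%:E)) ->
  measurable_fun [set: T] X ->
  (forall w, `|X w| <= C + \sum_(i < n) W (Y i w))%R ->
  P.-integrable [set: T] (fun w => (X w)%:E).
Proof.
move=> iW mX XC.
apply: (@le_integrable _ _ _ P _ _ _
    (fun w => C%:E + \sum_(i < n) (W (Y i w))%:E)) => //.
- exact/measurable_EFinP.
- move=> w _; rewrite sumEFin -EFinD !abse_EFin lee_fin.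
  by rewrite (le_trans (XC w))// ler_norm.
- apply: integrableD => //; first exact: finite_measure_integrable_cst.
  exact: integrable_sum.
Qed.

Lemma mgf_tensor n (Y : 'I_n -> {RV P >-> E}) (F : n.-tuple E -> R) (C : R) :
  (forall i, P.-integrable [set: T] (fun w => (W (Y i w))%:E)) ->
  mutually_independent Y ->
  measurable_fun [set: n.-tuple E] F ->
  (forall t, `|F t| <= C + \sum_(i < n) W (tnth t i))%R ->
  (forall i t t', (forall j, j != i -> tnth t j = tnth t' j) ->
    `|F t - F t'| <= (W (tnth t i) + W (tnth t' i)) / 2)%R ->
  \int[P]_w (expR (l * F (rv_tuple Y w)))%:E <=
    (expR (l * fine (\int[P]_w (F (rv_tuple Y w))%:E)))%:E *
    \prod_(i < n) \int[P]_w (cosh (l * W (Y i w)))%:E.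
Proof.
elim: n Y F C => [|n IHn] Y F C iW iY mF FC FW.
  have Ft t : F t = F [tuple] by rewrite (tuple0 t).
  under eq_integral do rewrite Ft.
  under [in leRHS]eq_integral do rewrite Ft.
  by rewrite !integral_cst//= probability_setT !mule1 big_ord0 mule1.
pose Y' : 'I_n -> {RV P >-> E} := Y \o lift ord0.
pose X0 := Y ord0.
pose X' : {RV P >-> n.-tuple E} := @rv_tuple _ _ T E R P n Y'.
pose F1 (p : E * n.-tuple E) : R := F [tuple of p.1 :: p.2].
have mF1 : measurable_fun setT F1.
  apply: measurableT_comp => //.
  exact: (measurable_cons measurable_fst measurable_snd).
have FE w : F (rv_tuple Y w) = F1 (X0 w, X' w).
  congr F; apply/eq_from_tnth => i; rewrite tnth_mktuple.
  by have [j ->|->] := unliftP ord0 i; rewrite ?tnthS ?tnth0//= tnth_mktuple.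
have iW' i : P.-integrable setT (fun w => (W (Y' i w))%:E) by exact: iW.
have iY' : mutually_independent Y' by exact: mutually_independent_lift.
have F1C y t : (`|F1 (y, t)| <= (C + W y) + \sum_(i < n) W (tnth t i))%R.
  apply: le_trans (FC _) _; rewrite big_ord_recl tnth0/= addrA.
  by under eq_bigr do rewrite tnthS.
have F1W y y' t : (`|F1 (y, t) - F1 (y', t)| <= (W y + W y') / 2)%R.
  have := FW ord0 [tuple of y :: t] [tuple of y' :: t]; rewrite !tnth0; apply.
  by move=> j; have [i ->|->] := unliftP ord0 j; rewrite ?eqxx// !tnthS.
have mFy y : measurable_fun setT (fun w => F1 (y, X' w)).
  apply: (@measurableT_comp _ _ _ _ _ _ (fun t => F1 (y, t))) => //.
  exact: measurableT_comp.
have iFy y : P.-integrable setT (fun w => (F1 (y, X' w))%:E).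
  apply: (integrable_le_sum (C := (C + W y)%R) iW') => // w.
  apply: le_trans (F1C _ _) _; rewrite lerD2l.
  by under eq_bigr do rewrite tnth_mktuple.
have iF : P.-integrable setT (fun w => (F1 (X0 w, X' w))%:E).
  apply: (integrable_le_sum (C := C) iW) => [|w].
    by apply: measurableT_comp => //; exact: measurable_fun_pair.
  rewrite -FE; apply: le_trans (FC _) _; rewrite lerD2l.
  by under eq_bigr do rewrite tnth_mktuple.
have indep := indep_head_tail iY.
have mEF1 : measurable_fun setT (EFin \o F1) by exact/measurable_EFinP.
pose G y := fine (\int[P]_w (F1 (y, X' w))%:E).
have GE y : (G y)%:E = \int[P]_w (F1 (y, X' w))%:E.
  by rewrite fineK//; exact: integrable_fin_num.
have mG : measurable_fun setT G.
  apply/measurable_EFinP; under [X in measurable_fun _ X]eq_fun do rewrite /= GE.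
  exact: (measurable_fun_integral_indep indep mEF1).
have iG : P.-integrable setT (EFin \o (G \o X0)).
  under [X in _.-integrable _ X]eq_fun do rewrite /= GE.
  exact: (integrable_integral_indep indep mEF1).
have EG : \int[P]_w (G (X0 w))%:E = \int[P]_w (F (rv_tuple Y w))%:E.
  under eq_integral do rewrite GE.
  under [in RHS]eq_integral do rewrite FE.
  by rewrite (integral_indep indep mEF1).
(* Averaging over the tail preserves the bounded difference in the head, with the same weight
   [W]. *)
have GW y y' : (`|G y - G y'| <= (W y + W y') / 2)%R.
  rewrite -lee_fin -abse_EFin EFinB !GE -integralB//.
  apply: (le_trans (le_abse_integral _ _ _)) => //.
    by apply: emeasurable_funB => //; exact/measurable_EFinP.
  rewrite -[leRHS]mule1 -(probability_setT P) -integral_cst//.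
  apply: ge0_le_integral => //.
  - by apply: measurableT_comp => //; apply: emeasurable_funB => //; exact/measurable_EFinP.
  - by move=> w _; rewrite -EFinB abse_EFin lee_fin.
under eq_integral do rewrite FE.
rewrite -EG.
have mexpF1 : measurable_fun setT (fun p => (expR (l * F1 p))%:E).
  apply/measurable_EFinP; apply: measurableT_comp => //.
  exact: measurable_funM.
rewrite (ge0_integral_indep indep mexpF1); last first.
  by move=> p; rewrite lee_fin expR_ge0.
rewrite big_ord_recl.
set Pi := \prod_(i < n) _.
have Pi0 : 0 <= Pi.
  by apply: prode_ge0 => i _; apply: integral_ge0 => w _; rewrite lee_fin cosh_ge0.
have IH y : \int[P]_w (expR (l * F1 (y, X' w)))%:E <= (expR (l * G y))%:E * Pi.
  apply: (IHn Y' (fun t => F1 (y, t)) (C + W y)%R) => //.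
  - exact: measurableT_comp.
  - move=> i t t' tt'.
    have := FW (lift ord0 i) [tuple of y :: t] [tuple of y :: t'].
    rewrite !tnthS; apply => j.
    have [k ->|-> _] := unliftP ord0 j; last by rewrite !tnth0.
    by rewrite (inj_eq lift_inj) !tnthS; exact: tt'.
have mexpG : measurable_fun setT (fun w => (expR (l * G (X0 w)))%:E).
  apply/measurable_EFinP; apply: measurableT_comp => //.
  by apply: measurable_funM => //; exact: measurableT_comp.
apply: (@le_trans _ _ (\int[P]_w ((expR (l * G (X0 w)))%:E * Pi))).
  apply: ge0_le_integral => //.
  - by move=> w _; apply: integral_ge0 => w' _; rewrite lee_fin expR_ge0.
  - apply: (@measurableT_comp _ _ _ _ _ _
      (fun y => \int[P]_w' (expR (l * F1 (y, X' w')))%:E)) => //.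
    by apply: (measurable_fun_ge0_integral_section X' mexpF1) => p;
      rewrite lee_fin expR_ge0.
  - exact: emeasurable_funM.
rewrite ge0_integralZr// muleA.
apply: lee_wpmul2r => //.
apply: (mgf_le_cosh (X := G \o X0) (V := W \o X0)) => //.
- exact: measurableT_comp.
- by move=> w w'; exact: GW.
Qed.

End mgf_tensorization.

(** * Truncation of the hyperbolic cosine *)

Section exponential_bounds.
Context (R : realType).
Implicit Types x y : R.

Lemma ge0_derive_le (f f' : R -> R) y : 0 <= y ->
  (forall x, is_derive x 1 f (f' x)) -> (forall x, 0 <= x -> 0 <= f' x) ->
  f 0 <= f y.
Proof.
move=> y0 ff' f'0.
apply: (@ger0_derive1_le_cc R f 0 y) => //.
- move=> x; rewrite in_itv/= => /andP[x0 _].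
  by rewrite derive1E (@derive_val _ _ _ _ _ _ _ (ff' x)) f'0// ltW.
- apply: derivable_within_continuous => x _.
  by have [] := ff' x.
- by rewrite in_itv/= lexx.
- by rewrite in_itv/= y0 lexx.
Qed.

Lemma expRN_le_quadratic y : 0 <= y -> expR (- y) <= 1 - y + y ^+ 2 / 2.
Proof.
move=> y0; pose f x : R := 1 - x + x ^+ 2 / 2 - expR (- x).
have : f 0 <= f y.
  apply: (@ge0_derive_le f (fun x => - 1 + x + expR (- x)) y y0) => [x|x _].
    by apply: is_derive_eq; rewrite /GRing.scale/=; lra.
  by have := expR_ge1Dx (- x); lra.
rewrite /f oppr0 expR0; lra.
Qed.

(** After multiplication by [expR (- y)] the derivative of the quadratic part collapses to
    [- y^2 / 2 expR (- y)], which the derivative of [y^3 / 6] dominates. *)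
Lemma expR_le_quadratic y : 0 <= y ->
  expR y <= 1 + y + y ^+ 2 / 2 + y ^+ 3 / 6 * expR y.
Proof.
move=> y0; pose f x : R := (1 + x + x ^+ 2 / 2) * expR (- x) + x ^+ 3 / 6.
have : f 0 <= f y.
  apply: (@ge0_derive_le f (fun x => x ^+ 2 / 2 * (1 - expR (- x))) y y0).
    by move=> x; apply: is_derive_eq; rewrite /GRing.scale/=; lra.
  move=> x x0; rewrite mulr_ge0 ?divr_ge0 ?sqr_ge0//.
  by rewrite subr_ge0 -expR0 ler_expR oppr_le0.
have -> : f 0 = 1 by rewrite /f oppr0 expR0; lra.
rewrite /f -(ler_pM2r (expR_gt0 y)) mul1r (mulrDl (_ * expR (- y))).
by rewrite -(mulrA _ (expR (- y))) -expRD addNr expR0 mulr1.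
Qed.

Lemma cosh_le y : 0 <= y ->
  cosh y <= 1 + y ^+ 2 / 2 * (1 + y / 6 * expR y).
Proof.
move=> y0; have := expRN_le_quadratic y0; have := expR_le_quadratic y0.
have : 0 <= y ^+ 3 / 6 * expR y by rewrite !mulr_ge0 ?expR_ge0 ?exprn_ge0.
rewrite /cosh !exprS expr0; lra.
Qed.

(** For [p > 1] this is Young's inequality for the product [s * 1] with conjugate exponents [p] and
    [p / (p - 1)], multiplied by [p]. *)
Lemma bernoulli_powR (s p : R) : 0 <= s -> 1 <= p -> 1 + p * (s - 1) <= s `^ p.
Proof.
move=> s0; rewrite le_eqVlt => /predU1P[<-|p1].
  by rewrite powRr1// mul1r; lra.
have p0 : 0 < p by lra.
have q0 : 0 < p / (p - 1) by rewrite divr_gt0//; lra.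
have pq : p^-1 + (p / (p - 1))^-1 = 1 by field; rewrite !gt_eqF//; lra.
have := conjugate_powR s0 ler01 p0 q0 pq.
rewrite powR1 mulr1 -(ler_pM2l p0).
have -> : p * (s `^ p / p + 1 / (p / (p - 1))) = s `^ p + (p - 1).
  by field; rewrite !gt_eqF//; lra.
lra.
Qed.

(* [s / c <= expR (s / c - 1)], cubed. *)
Lemma cube_le_expR (c s : R) : 0 < c -> 0 <= s ->
  s ^+ 3 <= c ^+ 3 * expR (3 * (s / c - 1)).
Proof.
move=> c0 s0; rewrite expRM_natl -exprMn lerXn2r ?nnegrE//.
  by rewrite mulr_ge0 ?expR_ge0// ltW.
rewrite -ler_pdivrMl// mulrC.
have := expR_ge1Dx (s / c - 1); lra.
Qed.

End exponential_bounds.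

(** The relative error allowed by [cosh_le] when [cosh y - 1] is replaced by [y^2 / 2]. *)
Definition cosh_excess (R : realType) (y : R) : R := y / 6 * expR y.

Lemma cosh_excess_ge0 (R : realType) (y : R) : 0 <= y -> 0 <= cosh_excess y.
Proof. by move=> y0; rewrite mulr_ge0 ?expR_ge0// divr_ge0. Qed.

Lemma le_cosh_excess (R : realType) (x y : R) : 0 <= x -> x <= y ->
  cosh_excess x <= cosh_excess y.
Proof.
move=> x0 xy; rewrite ler_pM ?expR_ge0 ?divr_ge0 ?ler_expR//.
by rewrite ler_wpM2r.
Qed.

Section truncation.
Context (R : realType) (alpha L eta kappa K l : R).
Hypotheses (alpha1 : 1 <= alpha) (L1 : 1 <= L) (l0 : 0 <= l) (K0 : 0 < K).
Let z := (4 * L) `^ alpha^-1.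
Let a := l * K * z.
(** With [s] the ratio of [v] to [k z], [expR (a s)] grows at rate [a] and [s^3] at rate at most
    [eta]; together they must not exceed the slope [4 alpha L] of Bernoulli's lower bound for
    [(v / k)^alpha]. *)
Hypothesis a_le : a + eta <= alpha * (4 * L).
Hypothesis kappaP : forall s, 1 <= s -> s ^+ 3 <= kappa * expR (eta * (s - 1)).

(** Here [16 L^2] bounds [z^2], [a / 6] comes from [cosh_excess], [kappa] pays for [s^3], and
    [expR (a - 4 L)] compares [expR (a s)] with the Orlicz exponential at the threshold [s = 1]. *)
Definition tail_const : R :=
  16 * L ^+ 2 * (a / 6) * kappa * expR (a - 4 * L).

Let alpha0 : 0 < alpha. Proof. exact: lt_le_trans alpha1. Qed.

Let L0 : 0 < L. Proof. exact: lt_le_trans L1. Qed.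

Let z_gt0 : 0 < z. Proof. by rewrite powR_gt0// mulr_gt0. Qed.

Let z_le : z <= 4 * L.
Proof. by rewrite ler1_powR ?invf_le1//; have := L1; lra. Qed.

Let powR_z : z `^ alpha = 4 * L.
Proof. by rewrite -powRrM mulVf ?gt_eqF// powRr1// mulr_ge0// ltW. Qed.

Let a_ge0 : 0 <= a.
Proof. by rewrite !mulr_ge0 ?(ltW K0) ?(ltW z_gt0). Qed.

Let kappa0 : 0 <= kappa.
Proof.
by have := kappaP (lexx 1); rewrite subrr mulr0 expR0 expr1n mulr1; lra.
Qed.

Lemma tail_const_ge0 : 0 <= tail_const.
Proof.
rewrite /tail_const mulr_ge0 ?expR_ge0// mulr_ge0 ?kappa0//.
apply: mulr_ge0; last by rewrite divr_ge0.
by rewrite mulr_ge0 ?sqr_ge0.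
Qed.

(* For [v <= k z] one has [l v <= a]; for [v = k z s] with [s > 1],
   [(v / k)^alpha >= 4 L (1 + alpha (s - 1))] by Bernoulli's inequality, which
   dominates [l v <= a s]. *)
Lemma truncated_excess_le (k v : R) : 0 < k <= K -> 0 <= v ->
  v ^+ 2 * cosh_excess (l * v) <=
    v ^+ 2 * cosh_excess a + k ^+ 2 * tail_const * expR ((v / k) `^ alpha).
Proof.
move=> /andP[k0 kK] v0.
pose s := v / (k * z).
have kz0 : 0 < k * z by rewrite mulr_gt0.
have vE : v = k * z * s by rewrite /s mulrC divfK// gt_eqF.
have s0 : 0 <= s by rewrite divr_ge0// ltW.
move: s vE s0 => s vE s0.
have lv : l * v <= a * s.
  rewrite vE /a !mulrA ler_wpM2r// ler_wpM2r ?(ltW z_gt0)//.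
  by rewrite ler_wpM2l.
have C0 : 0 <= k ^+ 2 * tail_const * expR ((v / k) `^ alpha).
  by rewrite !mulr_ge0 ?tail_const_ge0 ?expR_ge0 ?exprn_ge0// ltW.
have [s1|/ltW s1] := leP s 1.
  rewrite -[leLHS]addr0 lerD// ler_wpM2l ?sqr_ge0// le_cosh_excess ?mulr_ge0//.
  by rewrite (le_trans lv)// -[leRHS]mulr1 ler_wpM2l.
apply: (@le_trans _ _ (k ^+ 2 * tail_const * expR ((v / k) `^ alpha))); last first.
  by rewrite lerDr mulr_ge0 ?sqr_ge0 ?cosh_excess_ge0.
have ule : 4 * L * (1 + alpha * (s - 1)) <= (v / k) `^ alpha.
  rewrite vE; have -> : k * z * s / k = z * s by field; rewrite gt_eqF.
  rewrite powRM ?(ltW z_gt0)// powR_z ler_wpM2l ?bernoulli_powR//.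
  by rewrite mulr_ge0// ltW.
apply: (@le_trans _ _ (v ^+ 2 * cosh_excess (a * s))).
  by rewrite ler_wpM2l ?sqr_ge0// le_cosh_excess// mulr_ge0.
have z2 : z ^+ 2 <= 16 * L ^+ 2.
  have -> : 16 * L ^+ 2 = (4 * L) ^+ 2 by lra.
  by rewrite lerXn2r ?nnegrE ?(ltW z_gt0)// mulr_ge0// ltW.
(* The exponent is [eta (s - 1) + a s = a + (a + eta) (s - 1)], at most [a + 4 L alpha (s - 1)] by
   [a_le], hence at most [a - 4 L + (v / k)^alpha] by [ule]. *)
have key : s ^+ 3 * expR (a * s) <=
    kappa * (expR (a - 4 * L) * expR ((v / k) `^ alpha)).
  apply: (@le_trans _ _ (kappa * expR (eta * (s - 1)) * expR (a * s))).
    by rewrite ler_wpM2r ?expR_ge0// kappaP.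
  rewrite -mulrA ler_wpM2l// -!expRD ler_expR.
  have := ler_wpM2r (_ : 0 <= s - 1) a_le; rewrite subr_ge0 => /(_ s1).
  move: ule; lra.
have -> : v ^+ 2 * cosh_excess (a * s) =
    (k ^+ 2 * (a / 6)) * (z ^+ 2 * (s ^+ 3 * expR (a * s))).
  by rewrite vE /cosh_excess; field.
have -> : k ^+ 2 * tail_const * expR ((v / k) `^ alpha) = (k ^+ 2 * (a / 6)) *
   (16 * L ^+ 2 * (kappa * (expR (a - 4 * L) * expR ((v / k) `^ alpha)))).
  by rewrite /tail_const; field.
apply: ler_wpM2l; first by rewrite mulr_ge0 ?sqr_ge0// divr_ge0.
by apply: ler_pM; rewrite ?sqr_ge0// mulr_ge0 ?expR_ge0 ?exprn_ge0.
Qed.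

Lemma cosh_truncated_le (k v : R) : 0 < k <= K -> 0 <= v ->
  cosh (l * v) <= 1 + l ^+ 2 / 2 * ((1 + cosh_excess a) * v ^+ 2 +
    k ^+ 2 * tail_const * expR ((v / k) `^ alpha)).
Proof.
move=> kK v0; have := truncated_excess_le kK v0.
have := cosh_le (mulr_ge0 l0 v0); rewrite -/(cosh_excess (l * v)).
move=> h1 /(ler_wpM2l (_ : 0 <= l ^+ 2 / 2)).
rewrite divr_ge0 ?sqr_ge0// => /(_ isT) h2.
move: h1; rewrite exprMn; lra.
Qed.

End truncation.

(** * Orlicz norms *)

Section orlicz.
Context d (T : measurableType d) (R : realType) (P : probability T R).
Variables (alpha : R) (V : T -> R).
Hypotheses (alpha1 : 1 <= alpha) (mV : measurable_fun [set: T] V).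
Hypothesis V0 : forall w, 0 <= V w.
Local Open Scope ereal_scope.

Let alpha0 : (0 < alpha)%R. Proof. exact: lt_le_trans alpha1. Qed.

Let psiE (t : R) : (fun w => psi alpha (`|V w| / t)) =
  (fun w => expR ((V w / t) `^ alpha) - 1)%R.
Proof. by apply/funext => w; rewrite /psi ger0_norm. Qed.

Let mexp (t b : R) :
  measurable_fun [set: T] (fun w => (expR ((V w / t) `^ alpha * b))%:E).
Proof.
apply/measurable_EFinP; apply: measurableT_comp => //.
apply: measurable_funM => //.
apply: (@measurableT_comp _ _ _ _ _ _ (@powR R ^~ alpha)).
  exact: measurable_powR.
exact: measurable_funM.
Qed.

Let mexp1 (t : R) :
  measurable_fun [set: T] (fun w => (expR ((V w / t) `^ alpha))%:E).
Proof. by have := mexp t 1; under eq_fun do rewrite mulr1. Qed.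

Let expectation_psi (t : R) : 'E_P[fun w => psi alpha (`|V w| / t)] + 1 =
  \int[P]_w (expR ((V w / t) `^ alpha))%:E.
Proof.
rewrite psiE unlock.
have -> : 1 = \int[P]_w (1%:E : \bar R).
  by rewrite integral_cst//= probability_setT mule1.
rewrite -ge0_integralD//=.
- by apply: eq_integral => w _; rewrite /= -EFinD subrK.
- by move=> w _; rewrite lee_fin subr_ge0 -expR0 ler_expR powR_ge0.
- apply/measurable_EFinP; apply: measurable_funB => //.
  by have /measurable_EFinP := mexp1 t.
Qed.

Lemma orlicz_norm_ge0 : 0 <= orlicz_norm P alpha V.
Proof.
by apply: le_ereal_inf_tmp => _ [t [/ltW t0 _] <-]; rewrite lee_fin.
Qed.

Lemma orlicz_norm_lt (t : R) : orlicz_norm P alpha V < t%:E ->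
  \int[P]_w (expR ((V w / t) `^ alpha))%:E <= 2%:E.
Proof.
move=> /ereal_inf_lt[_ [u [u0 Eu] <-]]; rewrite lte_fin => ut.
apply: (@le_trans _ _ (\int[P]_w (expR ((V w / u) `^ alpha))%:E)).
  apply: ge0_le_integral => //.
  move=> w _; rewrite lee_fin ler_expR ge0_ler_powR ?nnegrE ?(ltW alpha0)//.
  - by rewrite divr_ge0// ltW// (lt_trans u0).
  - by rewrite divr_ge0// ltW.
  - by rewrite ler_wpM2l// lef_pV2 ?posrE ?ltW// (lt_trans u0).
by rewrite -expectation_psi (_ : 2%:E = 1 + 1) ?leeD2r// -EFinD.
Qed.

(** The infimum is attained: damping the exponent by [b n < 1] amounts to using a scale above [k],
    where the bound 2 holds, and monotone convergence lets [b n] increase to 1. *)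
Lemma orlicz_norm_attained (k : R) : (0 < k)%R -> orlicz_norm P alpha V = k%:E ->
  \int[P]_w (expR ((V w / k) `^ alpha))%:E <= 2%:E.
Proof.
move=> k0 kE.
(* Starting at [n.+2] makes [b 0] equal to [1 / 2], hence every [b n] positive. *)
pose b n : R := (1 - n.+2%:R^-1)%R.
have b01 n : (0 < b n < 1)%R.
  rewrite /b subr_gt0 invf_lt1 ?ltr0n// ltr1n/=.
  by rewrite gtrBl invr_gt0 ltr0n.
have nd_b n m : (n <= m)%N -> (b n <= b m)%R.
  by move=> nm; rewrite lerD2l lerN2 lef_pV2 ?posrE ?ltr0n// ler_nat.
have cvgb : b n @[n --> \oo] --> (1 : R)%R.
  rewrite -[X in _ --> X]subr0; apply: cvgB; first exact: cvg_cst.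
  by have := @cvg_harmonic R; rewrite -cvg_shiftS.
have -> : \int[P]_w (expR ((V w / k) `^ alpha))%:E =
    \int[P]_w (limn (fun n => (expR ((V w / k) `^ alpha * b n))%:E)).
  apply: eq_integral => w _; apply/esym/cvg_lim => //.
  apply: cvg_EFin; first exact: nearW.
  rewrite -[X in _ --> expR X]mulr1.
  apply: continuous_cvg; first exact: continuous_expR.
  by apply: cvgM => //; exact: cvg_cst.
rewrite monotone_convergence//; last first.
  move=> w _ n m nm; rewrite lee_fin ler_expR ler_wpM2l ?powR_ge0//.
  exact: nd_b.
apply: lime_le.
  apply: ereal_nondecreasing_is_cvgn => n m nm; apply: ge0_le_integral => //.
  by move=> w _; rewrite lee_fin ler_expR ler_wpM2l ?powR_ge0// nd_b.
apply: nearW => n; have /andP[b0 b1] := b01 n.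
(* The scale for which [(V / t)^alpha = b n (V / k)^alpha]. *)
pose t := (k * (b n) `^ (- alpha^-1))%R.
have kt : (k < t)%R.
  rewrite /t -ltr_pdivrMl// mulVf ?gt_eqF// powRN invf_gt1 ?powR_gt0//.
  apply: (@lt_le_trans _ _ (1 `^ alpha^-1)%R); last by rewrite powR1.
  by rewrite gt0_ltr_powR ?invr_gt0 ?nnegrE// ltW.
have -> : \int[P]_w (expR ((V w / k) `^ alpha * b n))%:E =
    \int[P]_w (expR ((V w / t) `^ alpha))%:E.
  apply: eq_integral => w _; congr (expR _)%:E.
  have u0 : (0 <= V w / k)%R by rewrite divr_ge0// ltW.
  rewrite /t invfM mulrA; set u := (V w / k)%R in u0 *.
  rewrite powRM ?invr_ge0 ?powR_ge0//.
  by rewrite powRN invrK -powRrM mulVf ?gt_eqF// powRr1// ltW.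
by apply: orlicz_norm_lt; rewrite kE lte_fin.
Qed.

(** Pointwise [u^2 <= 2 expR (u^alpha)] at [u = V / t]; the expectation of the exponential
    contributes the other factor 2. *)
Lemma le_orlicz_sqr (t : R) : orlicz_norm P alpha V < t%:E ->
  \int[P]_w (V w ^+ 2)%:E <= (4 * t ^+ 2)%:E.
Proof.
move=> Vt; have t0 : (0 < t)%R.
  by rewrite -lte_fin (le_lt_trans orlicz_norm_ge0).
have exp2 := orlicz_norm_lt Vt.
apply: (@le_trans _ _ (\int[P]_w ((2 * t ^+ 2)%:E *
    (expR ((V w / t) `^ alpha))%:E))).
  apply: ge0_le_integral => //.
  - by move=> w _; rewrite lee_fin sqr_ge0.
  - by apply/measurable_EFinP; exact: measurable_funX.
  - exact: measurable_funeM.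
  - move=> w _; rewrite -EFinM lee_fin.
    set u := (V w / t)%R.
    have u0 : (0 <= u)%R by rewrite divr_ge0// ltW.
    have -> : V w = (u * t)%R by rewrite /u divfK// gt_eqF.
    rewrite exprMn [X in (_ <= X)%R]mulrAC [(u ^+ 2 * _)%R]mulrC mulrC.
    rewrite ler_wpM2r ?sqr_ge0//.
    have [u1|/ltW u1] := leP u 1%R.
      apply: (@le_trans _ _ (2 * 1)%R); first by rewrite expr2; nra.
      by rewrite ler_wpM2l// -expR0 ler_expR powR_ge0.
    apply: (@le_trans _ _ (2 * expR u)%R); last first.
      by rewrite ler_wpM2l// ler_expR le1r_powR.
    have := expR_ge1Dxn 1 u0; rewrite (_ : 2`! = 2)%N//; lra.
rewrite ge0_integralZl//; last by rewrite lee_fin mulr_ge0 ?sqr_ge0.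
apply: (@le_trans _ _ ((2 * t ^+ 2)%:E * 2%:E)).
  by apply: lee_wpmul2l => //; rewrite lee_fin mulr_ge0 ?sqr_ge0.
by rewrite -EFinM lee_fin; lra.
Qed.

Lemma orlicz_sqr_lty : orlicz_norm P alpha V < +oo ->
  \int[P]_w (V w ^+ 2)%:E < +oo.
Proof.
move=> Voo.
have Vfin : orlicz_norm P alpha V \is a fin_num.
  by rewrite ge0_fin_numE// orlicz_norm_ge0.
apply: le_lt_trans (ltry _); apply: (@le_orlicz_sqr (fine (orlicz_norm P alpha V) + 1)%R).
by rewrite EFinD fineK// lteDl// lte_fin.
Qed.

Lemma orlicz0_sqr : orlicz_norm P alpha V = 0 -> \int[P]_w (V w ^+ 2)%:E = 0.
Proof.
move=> V00; apply/eqP; rewrite eq_le integral_ge0 ?andbT; last first.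
  by move=> w _; rewrite lee_fin sqr_ge0.
apply/lee_addgt0Pr => e e0; rewrite add0e.
have -> : e = (4 * (Num.sqrt e / 2) ^+ 2)%R.
  by rewrite exprMn sqr_sqrtr ?ltW//; lra.
by apply: le_orlicz_sqr; rewrite V00 lte_fin divr_gt0// sqrtr_gt0.
Qed.

End orlicz.

(** * Expectation of the hyperbolic cosine *)

Section cosh_moment.
Context d (T : measurableType d) (R : realType) (P : probability T R).
Variables (alpha L eta kappa K l : R).
Hypotheses (alpha1 : 1 <= alpha) (L1 : 1 <= L) (l0 : 0 <= l) (K0 : 0 < K).
Let z := (4 * L) `^ alpha^-1.
Let a := l * K * z.
Let C := tail_const alpha L kappa K l.
Hypothesis a_le : a + eta <= alpha * (4 * L).
Hypothesis kappaP : forall s, 1 <= s -> s ^+ 3 <= kappa * expR (eta * (s - 1)).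
Local Open Scope ereal_scope.

Let a0 : (0 <= a)%R.
Proof. by rewrite !mulr_ge0 ?powR_ge0 ?(ltW K0). Qed.

Let C0 : (0 <= C)%R.
Proof. exact: tail_const_ge0 kappaP. Qed.

Lemma cosh_moment_le (V : T -> R) (k : R) :
  measurable_fun [set: T] V -> (forall w, 0 <= V w)%R ->
  orlicz_norm P alpha V = k%:E -> (k <= K)%R ->
  \int[P]_w (cosh (l * V w))%:E <=
  (1 + l ^+ 2 / 2 * ((1 + cosh_excess a) * fine (\int[P]_w (V w ^+ 2)%:E) +
     2 * k ^+ 2 * C))%:E.
Proof.
move=> mV V0 Vk kK.
have k0 : (0 <= k)%R by rewrite -lee_fin -Vk orlicz_norm_ge0.
have mV2 : measurable_fun [set: T] (fun w => (V w ^+ 2)%:E).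
  by apply/measurable_EFinP; exact: measurable_funX.
have V2ge0 : 0 <= \int[P]_w (V w ^+ 2)%:E.
  by apply: integral_ge0 => w _; rewrite lee_fin sqr_ge0.
have mcosh : measurable_fun [set: T] (fun w => (cosh (l * V w))%:E).
  apply/measurable_EFinP; apply: measurableT_comp; first exact: measurable_cosh.
  exact: measurable_funM.
have V2fin : \int[P]_w (V w ^+ 2)%:E \is a fin_num.
  rewrite ge0_fin_numE//.
  by apply: (orlicz_sqr_lty alpha1 mV V0); rewrite Vk ltry.
have eps0 := cosh_excess_ge0 a0.
(* When [k = 0] the scale [V / k] is meaningless, but then [V] vanishes almost surely and the
   expectation is 1. *)
move: k0; rewrite le_eqVlt => /predU1P[k0|k0].
  have V20 : \int[P]_w (V w ^+ 2)%:E = 0.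
    by apply: (orlicz0_sqr alpha1 mV V0); rewrite Vk -k0.
  rewrite V20 -k0 mulr0 expr0n mulr0 mul0r addr0 mulr0 addr0.
  have -> : \int[P]_w (cosh (l * V w))%:E = \int[P]_w (cst 1%:E w).
    apply: ge0_ae_eq_integral => //.
    + by move=> w _; rewrite lee_fin cosh_ge0.
    + have : \int[P]_w `|(V w ^+ 2)%:E| = 0.
        rewrite -[RHS]V20; apply: eq_integral => w _.
        by rewrite gee0_abs// lee_fin sqr_ge0.
      move/(ae_eq_integral_abs P measurableT mV2); apply: filterS => w /= /(_ I) [].
      move=> /eqP; rewrite sqrf_eq0 => /eqP -> _.
      by rewrite mulr0 /cosh oppr0 expR0 -[(1 + 1)%R]/(2%:R : R) divff.
  by rewrite integral_cst//= probability_setT mule1.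
have exp2 := orlicz_norm_attained alpha1 mV V0 k0 Vk.
have mexp : measurable_fun setT (fun w => (expR ((V w / k) `^ alpha))%:E).
  apply/measurable_EFinP; apply: measurableT_comp => //.
  apply: (@measurableT_comp _ _ _ _ _ _ (@powR R ^~ alpha)).
    exact: measurable_powR.
  exact: measurable_funM.
pose c1 := (l ^+ 2 / 2 * (1 + cosh_excess a))%R.
pose c2 := (l ^+ 2 / 2 * (k ^+ 2 * C))%R.
have c10 : (0 <= c1)%R.
  by rewrite /c1 mulr_ge0 ?divr_ge0 ?sqr_ge0 ?addr_ge0.
have c20 : (0 <= c2)%R.
  by rewrite /c2 mulr_ge0 ?divr_ge0 ?sqr_ge0// mulr_ge0 ?sqr_ge0.
apply: (@le_trans _ _ (\int[P]_w (1%:E + (c1%:E * (V w ^+ 2)%:E +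
   c2%:E * (expR ((V w / k) `^ alpha))%:E)))).
  apply: ge0_le_integral => //.
  - by move=> w _; rewrite lee_fin cosh_ge0.
  - apply: emeasurable_funD => //.
    by apply: emeasurable_funD; exact: measurable_funeM.
  - move=> w _; rewrite -!EFinM -!EFinD lee_fin.
    have kK' : (0 < k <= K)%R by rewrite k0 kK.
    have := cosh_truncated_le alpha1 L1 l0 K0 a_le kappaP kK' (V0 w).
    by rewrite /c1 /c2 -/C -/z -/a; lra.
rewrite ge0_integralD//; last 2 first.
  - move=> w _; rewrite -!EFinM -EFinD lee_fin.
    by rewrite addr_ge0// mulr_ge0 ?sqr_ge0 ?expR_ge0.
  - by apply: emeasurable_funD; exact: measurable_funeM.
rewrite integral_cst//= probability_setT mule1.
rewrite ge0_integralD//; last 4 first.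
  - by move=> w _; rewrite -EFinM lee_fin mulr_ge0 ?sqr_ge0.
  - exact: measurable_funeM.
  - by move=> w _; rewrite -EFinM lee_fin mulr_ge0 ?expR_ge0.
  - exact: measurable_funeM.
rewrite !ge0_integralZl//; last by move=> w _; rewrite lee_fin sqr_ge0.
rewrite EFinD leeD2l// -(fineK V2fin).
apply: (@le_trans _ _ (c1%:E * (fine (\int[P]_w (V w ^+ 2)%:E))%:E + c2%:E * 2%:E)).
  by rewrite leeD2l// lee_wpmul2l.
by rewrite -!EFinM -EFinD lee_fin /c1 /c2 fineK//; lra.
Qed.

End cosh_moment.

Lemma prode_le_expR (R : realType) n (F : 'I_n -> \bar R) (del : 'I_n -> R) :
  (forall i, 0 <= F i)%E -> (forall i, F i <= (1 + del i)%:E)%E ->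
  (\prod_(i < n) F i <= (expR (\sum_(i < n) del i))%:E)%E.
Proof.
move=> F0 Fdel; rewrite expR_sum.
apply: (@le_trans _ _ (\prod_(i < n) (expR (del i))%:E)%E).
  elim: n F del F0 Fdel => [|n IH] F del F0 Fdel; first by rewrite !big_ord0.
  rewrite !big_ord_recl; apply: lee_pmul => //.
  - by apply: prode_ge0 => i _.
  - by apply: le_trans (Fdel _) _; rewrite lee_fin expR_ge1Dx.
  - exact: IH.
by rewrite prodEFin.
Qed.

(** * Choice of the Laplace parameter *)

Section numeric.
Context (R : realType).
Implicit Types (a b c x s L sigma : R).

(** The quadratic bound at [1 / 4] gives [25 / 32]; its fourth power is below [3 / 8]. *)
Lemma expRN1_le : expR (- 1) <= 3 / 8 :> R.
Proof.
have h := @expRN_le_quadratic R (1 / 4) ltac:(lra).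
have -> : (- 1 : R) = 4%:R * - (1 / 4) by lra.
rewrite expRM_natl; apply: (@le_trans _ _ ((25 / 32) ^+ 4)); last by lra.
by rewrite lerXn2r ?nnegrE ?expR_ge0//; lra.
Qed.

Lemma expRNnat_le n : expR (- n%:R) <= (3 / 8) ^+ n :> R.
Proof.
rewrite -mulrN1 expRM_natl lerXn2r ?nnegrE ?expR_ge0 ?expRN1_le//; lra.
Qed.

(** [cube_le_expR] with [c = 9 / 8], the value giving rate [3 / c = 8 / 3]. This pair of small
    [kappa] and large rate serves small [a]; the next lemma trades a larger [kappa] for a smaller
    rate. *)
Lemma cube_le_expR_small s : 1 <= s -> s ^+ 3 <= 2 * expR (8 / 3 * (s - 1)).
Proof.
move=> s1; have := @cube_le_expR R (9 / 8) s ltac:(lra) ltac:(lra).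
move=> /le_trans; apply; apply: ler_pM; [lra|exact: expR_ge0|lra|].
rewrite ler_expR; lra.
Qed.

Lemma cube_le_expR_large s : 1 <= s -> s ^+ 3 <= 7 * expR (8 / 9 * (s - 1)).
Proof.
move=> s1; have := @cube_le_expR R (27 / 8) s ltac:(lra) ltac:(lra).
move=> /le_trans; apply.
apply: (@le_trans _ _ ((27 / 8) ^+ 3 * (expR (- 2%:R) * expR (8 / 9 * (s - 1))))).
  by rewrite -expRD; apply: ler_wpM2l; [lra|rewrite ler_expR; lra].
rewrite mulrA ler_wpM2r ?expR_ge0//.
apply: (@le_trans _ _ ((27 / 8) ^+ 3 * (3 / 8) ^+ 2)); last by lra.
by apply: ler_wpM2l; [lra|exact: expRNnat_le].
Qed.

(** The factor [expR (2 L - 2)] is the price of turning [U^2] into [sigma^2]. With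
    [L^2 <= expR (2 (L - 1))] the exponents add up to [a - 4], and [expR (- 4) <= 1 / 50] yields
    [8 / 75 = 2 * 16 / (6 * 50)]; the term [1 / 6] is [cosh_excess]. *)
Lemma tail_const_le (alpha L kappa K l theta : R) :
  1 <= L -> 0 <= kappa -> 0 <= l * K * (4 * L) `^ alpha^-1 ->
  1 / 6 + 8 / 75 * kappa <= theta ->
  let a := l * K * (4 * L) `^ alpha^-1 in
  1 + cosh_excess a + 2 * tail_const alpha L kappa K l * expR (2 * L - 2) <=
  1 + theta * (a * expR a).
Proof.
move=> L1 kappa0; set a := l * K * _ => a0 kappatheta /=.
rewrite -addrA lerD2l /tail_const -/a.
have L2 : L ^+ 2 <= expR (2%:R * (L - 1)).
  rewrite expRM_natl lerXn2r ?nnegrE ?expR_ge0//; first lra.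
  by have := expR_ge1Dx (L - 1); lra.
have e4 : expR (- 4%:R) <= 1 / 50 :> R.
  by apply: le_trans (expRNnat_le 4) _; lra.
have LL : L ^+ 2 * (expR (a - 4 * L) * expR (2 * L - 2)) <= expR a / 50.
  apply: (@le_trans _ _ (expR (2%:R * (L - 1)) *
      (expR (a - 4 * L) * expR (2 * L - 2)))).
    by rewrite ler_wpM2r// mulr_ge0 ?expR_ge0.
  rewrite -!expRD.
  have -> : 2%:R * (L - 1) + (a - 4 * L + (2 * L - 2)) = a + - 4%:R by lra.
  by rewrite expRD; apply: ler_wpM2l; [exact: expR_ge0|lra].
have := ler_wpM2l (mulr_ge0 a0 kappa0) LL.
have := ler_wpM2r (mulr_ge0 a0 (expR_ge0 a)) kappatheta.
rewrite /cosh_excess; lra.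
Qed.

(** With [c = 3 b / 4] and [w = c l], the correction is at most [1 / (1 - w)], the sub-gamma form;
    for [l = q / (sigma + c q)] the sub-gamma exponent equals [x] exactly. *)
Lemma bernstein_choice sigma b x : 0 < sigma -> 0 < b -> 0 < x ->
  exists l, [/\ 0 < l, l * b <= 4 / 3 &
   x <= l * (sigma * Num.sqrt (2 * x) + 3 / 4 * b * x) -
     l ^+ 2 * sigma ^+ 2 / 2 * (1 + 2 / 5 * (l * b * expR (l * b)))].
Proof.
move=> s0 b0 x0.
set q := Num.sqrt (2 * x).
have q0 : 0 < q by rewrite sqrtr_gt0 mulr_gt0.
have q2 : x = q ^+ 2 / 2 by rewrite sqr_sqrtr; lra.
pose c := 3 / 4 * b.
have c0 : 0 < c by rewrite mulr_gt0//; lra.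
have D0 : 0 < sigma + c * q by rewrite addr_gt0// mulr_gt0.
pose l := q / (sigma + c * q).
have l0 : 0 < l by rewrite divr_gt0.
pose w := c * l.
have w1 : 1 - w = sigma / (sigma + c * q).
  by rewrite /w /l; field; rewrite gt_eqF.
have w1gt : 0 < 1 - w by rewrite w1 divr_gt0.
have w0 : 0 < w by rewrite mulr_gt0.
have lb : l * b = 4 / 3 * w by rewrite /w /c; lra.
(* From [1 - w <= expR (- w)] and [w < 1] the product is at most [expR (1 / 3)], and
   [expR (- 1 / 3) >= 2 / 3]. *)
have ew : (1 - w) * expR (4 / 3 * w) <= 3 / 2.
  have e1 := expR_ge1Dx (- w).
  have e3 := expR_ge1Dx (- (1 / 3) : R).
  apply: (@le_trans _ _ (expR (- w) * expR (4 / 3 * w))).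
    by rewrite ler_wpM2r ?expR_ge0//; lra.
  rewrite -expRD (@le_trans _ _ (expR (1 / 3)))//.
    by rewrite ler_expR; lra.
  have := expR_gt0 (1 / 3 : R).
  have : expR (1 / 3) * expR (- (1 / 3)) = 1 :> R by rewrite -expRD subrr expR0.
  nra.
exists l; split => //; first by rewrite lb; lra.
have main : 1 + 2 / 5 * (l * b * expR (l * b)) <= (1 - w)^-1.
  rewrite lb -[leRHS]mul1r ler_pdivlMr//.
  have := ler_wpM2l (ltW w0) ew; lra.
have p0 : 0 <= l ^+ 2 * sigma ^+ 2 / 2 by rewrite divr_ge0// -exprMn sqr_ge0.
have := ler_wpM2l p0 main.
suff : x = l * (sigma * q + 3 / 4 * b * x) -
    l ^+ 2 * sigma ^+ 2 / 2 * (1 - w)^-1 by rewrite -/q; lra.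
rewrite w1 -/c q2 /l; field.
by rewrite !gt_eqF.
Qed.

(** At [l = m / (3 b)] the linear term is [4 x / 3], so the quadratic one may use [x / 3]. As [x]
    dominates [(sigma / b)^2 expR (3 a)] with [a = m / 3], this reduces to [key]. *)
Lemma bennett_choice sigma b x m : 0 < sigma -> 0 < b -> 16 / 3 <= m ->
  (sigma / b) ^+ 2 * expR m <= x ->
  x <= (m / (3 * b)) * (4 * b * x / m) -
    (m / (3 * b)) ^+ 2 * sigma ^+ 2 / 2 * (1 + 1 * (m / 3 * expR (m / 3))).
Proof.
move=> s0 b0 m0 xm.
have mgt : 0 < m by lra.
have -> : (m / (3 * b)) * (4 * b * x / m) = 4 / 3 * x.
  by field; rewrite !gt_eqF.
pose a := m / 3; rewrite -/a.
have -> : (m / (3 * b)) ^+ 2 * sigma ^+ 2 = (sigma / b) ^+ 2 * a ^+ 2.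
  by rewrite /a; field; rewrite !gt_eqF.
have a0 : 16 / 9 <= a by rewrite /a; lra.
have em : expR m = expR a ^+ 3 by rewrite -expRM_natl /a; congr expR; lra.
have a3 : a ^+ 3 <= 3 / 2 * expR a.
  have := @cube_le_expR R 3 a ltac:(lra) ltac:(lra).
  have -> : 3 * (a / 3 - 1) = a + - 3%:R by lra.
  rewrite expRD; have := expRNnat_le 3; have := expR_gt0 a; nra.
have a2 : a ^+ 2 <= a ^+ 3 by rewrite !exprS expr0; nra.
(* For [u = expR a >= 7 / 2] one has [3 / 2 (1 + u) <= 2 / 3 u^2], which closes [key]. *)
have ea : 7 / 2 <= expR a.
  rewrite [a]splitr expRD; have := expR_ge1Dx (a / 2); nra.
have key : a ^+ 2 * (1 + a * expR a) <= 2 / 3 * expR a ^+ 3.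
  apply: (@le_trans _ _ (3 / 2 * expR a * (1 + expR a))).
    have := expR_gt0 a; move: a3 a2; rewrite !exprS expr0; nra.
  have := expR_gt0 a; rewrite !exprS expr0; nra.
have := ler_wpM2l (sqr_ge0 (sigma / b)) key.
move: xm; rewrite em; lra.
Qed.

End numeric.

(** * Chernoff's bound for the deviation event *)

Lemma chernoff_complement d (T : measurableType d) (R : realType)
    (P : probability T R) (X : {RV P >-> R}) (m l B t x : R) :
  0 < l ->
  (\int[P]_w (expR (l * X w))%:E <= (expR (l * m))%:E * (expR B)%:E)%E ->
  x <= l * t - B ->
  ((1 - expR (- x))%:E <= P [set w | (X w)%:E - m%:E <= t%:E])%E.
Proof.
move=> l0 XB xB.
have mX : measurable_fun [set: T] X by [].
set A := [set w | _].
have AE : A = ~` [set w | m + t < X w].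
  apply/seteqP; split => w; rewrite /A /= -EFinB lee_fin.
    by move=> h; apply/negP; rewrite -leNgt; lra.
  by move/negP; rewrite -leNgt; lra.
have mC : measurable [set w | m + t < X w].
  rewrite (_ : [set w | _] = X @^-1` `]m + t, +oo[%classic).
    by rewrite -[X in measurable X]setTI; exact: mX.
  by apply/seteqP; split => w /=; rewrite in_itv/= andbT.
rewrite AE probability_setC// EFinB leeB//.
apply: (@le_trans _ _ (P [set w | X w >= m + t])).
  apply: le_measure; rewrite ?inE//.
    rewrite (_ : [set w | _] = X @^-1` `[m + t, +oo[%classic).
      by rewrite -[X in measurable X]setTI; exact: mX.
    by apply/seteqP; split => w /=; rewrite in_itv/= andbT.
  by move=> w /= /ltW.
apply: (le_trans (chernoff X (m + t) l0)).
have -> : 'M_P X l = (\int[P]_w (expR (l * X w))%:E)%E.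
  by rewrite /mmt_gen_fun unlock; apply: eq_integral => w _ /=; rewrite mulrC.
apply: (@le_trans _ _ ((expR (l * m))%:E * (expR B)%:E * (expR (- (l * (m + t))))%:E)%E).
  by apply: lee_wpmul2r => //; rewrite lee_fin expR_ge0.
by rewrite -!EFinM -!expRD lee_fin ler_expR; lra.
Qed.

(** * Concentration of half the norm of the sum *)

Section half_norm_sum.
Context (dE : measure_display) (R : realType)
  (E : measurableNormedModType dE R) (n : nat).
Implicit Types t : n.-tuple E.

Lemma half_norm_sum_le t : `|half_norm_sum t| <= \sum_(i < n) `|tnth t i|.
Proof.
rewrite /half_norm_sum normrM normr_id.
apply: (@le_trans _ _ `|\sum_(i < n) tnth t i|); last exact: ler_norm_sum.
by rewrite ler_piMl// ger0_norm ?invr_ge0// invf_le1// ler1n.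
Qed.

(** The reverse triangle inequality leaves half of [|t_i - t'_i|]; the factor [1 / 2] in
    [half_norm_sum] matches the average of weights that symmetrization requires. *)
Lemma half_norm_sum_lipschitz i t t' :
  (forall j, j != i -> tnth t j = tnth t' j) ->
  `|half_norm_sum t - half_norm_sum t'| <= (`|tnth t i| + `|tnth t' i|) / 2.
Proof.
move=> tt'; rewrite /half_norm_sum -mulrBr normrM ger0_norm ?invr_ge0// mulrC.
rewrite ler_wpM2r ?invr_ge0//; apply: le_trans (ler_dist_dist _ _) _.
rewrite (bigD1 i)//= [X in _ - X](bigD1 i)//= (eq_bigr (tnth t')); last first.
  by move=> j ji; exact: tt'.
by rewrite opprD addrACA subrr addr0; exact: ler_normB.
Qed.

End half_norm_sum.

Section concentration.
Context (R : realType) (d dE : measure_display) (T : measurableType d)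
  (P : probability T R) (E : measurableNormedModType dE R) (n : nat)
  (Y : 'I_n -> {RV P >-> E}) (alpha : R).
Let f : n.-tuple E -> R := @half_norm_sum dE R E n.
Hypothesis alpha1 : 1 <= alpha.
Hypothesis mnorm : measurable_fun [set: E] (fun y : E => `|y|).
Hypothesis mf : measurable_fun [set: n.-tuple E] f.
Hypothesis iY : mutually_independent Y.
Hypothesis Koo : (max_psi_norm alpha Y < +oo)%E.
Hypothesis sigma_gt0e : (0 < l2_norm Y)%E.

Let K := fine (max_psi_norm alpha Y).
Let U := fine (l2_psi_norm alpha Y).
Let sigma := fine (l2_norm Y).
Let L := logbar (expR 1 * U / sigma).
Let z := (4 * L) `^ alpha^-1.
Let fY : T -> R := fun w => f [tuple Y i w | i < n].
Let k i := fine (psi_norm alpha Y i).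
Let e i := fine (\int[P]_w (`|Y i w| ^+ 2)%:E)%E.

Let mV i : measurable_fun [set: T] (fun w => `|Y i w|).
Proof. by apply: (measurableT_comp mnorm). Qed.

Let V0 i w : 0 <= `|Y i w|. Proof. by []. Qed.

Let psi_ge0 i : (0 <= psi_norm alpha Y i)%E.
Proof. exact: orlicz_norm_ge0. Qed.

Let psi_le i : (psi_norm alpha Y i <= max_psi_norm alpha Y)%E.
Proof. exact: le_bigmax. Qed.

Let psi_lty i : (psi_norm alpha Y i < +oo)%E.
Proof. exact: le_lt_trans (psi_le i) Koo. Qed.

Let psiE i : psi_norm alpha Y i = (k i)%:E.
Proof. by rewrite fineK// ge0_fin_numE. Qed.

Let eE i : (\int[P]_w (`|Y i w| ^+ 2)%:E)%E = (e i)%:E.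
Proof.
rewrite fineK// ge0_fin_numE; last first.
  by apply: integral_ge0 => w _; rewrite lee_fin sqr_ge0.
exact: (orlicz_sqr_lty alpha1 (mV i) (V0 i) (psi_lty i)).
Qed.

Let e_ge0 i : 0 <= e i.
Proof. by apply: fine_ge0; apply: integral_ge0 => w _; rewrite lee_fin sqr_ge0. Qed.

Let k_ge0 i : 0 <= k i.
Proof. by rewrite -lee_fin -psiE. Qed.

Let l2_normE : l2_norm Y = (Num.sqrt (\sum_(i < n) e i))%:E.
Proof.
rewrite /l2_norm (eq_bigr (fun i => (e i)%:E)) ?sumEFin// => i _.
by rewrite unlock eE.
Qed.

Let sigmaE : sigma ^+ 2 = \sum_(i < n) e i.
Proof. by rewrite /sigma l2_normE/= sqr_sqrtr// sumr_ge0. Qed.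

Let sigma_gt0 : 0 < sigma.
Proof. by move: sigma_gt0e; rewrite l2_normE lte_fin /sigma l2_normE. Qed.

Let UE : U = Num.sqrt (\sum_(i < n) k i ^+ 2).
Proof.
rewrite /U /l2_psi_norm (eq_bigr (fun i => (k i ^+ 2)%:E)) ?sumEFin// => i _.
by rewrite psiE EFin_expe.
Qed.

Let U2 : U ^+ 2 = \sum_(i < n) k i ^+ 2.
Proof. by rewrite UE sqr_sqrtr// sumr_ge0// => i _; exact: sqr_ge0. Qed.

Let n_gt0 : (0 < n)%N.
Proof.
rewrite lt0n; apply/eqP => n0; move: sigma_gt0.
suff : sigma ^+ 2 = 0 by move/eqP; rewrite sqrf_eq0 => /eqP ->; rewrite ltxx.
by rewrite sigmaE big1// => -[i ilt]; exfalso; move: ilt; rewrite n0.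
Qed.

(** The maximum starts from [-oo], so an actual index is needed to make it nonnegative, hence
    finite. *)
Let KE : max_psi_norm alpha Y = K%:E.
Proof.
rewrite fineK// ge0_fin_numE//.
exact: le_trans (psi_ge0 (Ordinal n_gt0)) (psi_le _).
Qed.

Let k_le i : k i <= K.
Proof. by rewrite -lee_fin -psiE -KE. Qed.

(** If [K] vanished, all second moments would vanish, and [sigma] with them. *)
Let K_gt0 : 0 < K.
Proof.
rewrite ltNge; apply/negP => K0; move: sigma_gt0.
suff : sigma ^+ 2 = 0 by move/eqP; rewrite sqrf_eq0 => /eqP ->; rewrite ltxx.
rewrite sigmaE big1// => i _.
have ki0 : k i = 0 by apply/eqP; rewrite eq_le k_ge0 (le_trans (k_le i)).
have psi0 : psi_norm alpha Y i = 0%E by rewrite psiE ki0.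
by rewrite /e (orlicz0_sqr alpha1 (mV i) (V0 i) psi0).
Qed.

Let L_ge1 : 1 <= L.
Proof. by rewrite /L /logbar le_max lexx orbT. Qed.

(** Since [L >= ln (e U / sigma)], [U <= sigma expR (L - 1)]; this is the role of the logarithm in
    [z]. *)
Let U2_le : U ^+ 2 <= sigma ^+ 2 * expR (2 * L - 2).
Proof.
have U0 : 0 <= U by rewrite UE sqrtr_ge0.
suff UL : U <= sigma * expR (L - 1).
  have -> : 2 * L - 2 = 2%:R * (L - 1) by lra.
  by rewrite expRM_natl -exprMn lerXn2r ?nnegrE ?mulr_ge0 ?expR_ge0 ?(ltW sigma_gt0).
move: U0; rewrite le_eqVlt => /predU1P[<-|U0].
  by rewrite mulr_ge0 ?expR_ge0// ltW.
have pos : 0 < expR 1 * U / sigma by rewrite !mulr_gt0 ?expR_gt0 ?invr_gt0.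
have : expR 1 * U / sigma <= expR L.
  by rewrite -[leLHS]lnK ?posrE// ler_expR /L /logbar le_max lexx.
rewrite ler_pdivrMr// => h; rewrite -(ler_pM2l (expR_gt0 1)).
apply: le_trans h _.
by rewrite mulrCA -expRD [expR _ * _]mulrC (_ : 1 + (L - 1) = L)//; lra.
Qed.

Let integrable_norm i : P.-integrable [set: T] (fun w => (`|Y i w|)%:E).
Proof.
apply: (@le_integrable _ _ _ P _ _ _ (fun w => 1%:E + (`|Y i w| ^+ 2)%:E)%E) => //.
- exact/measurable_EFinP.
- move=> w _; rewrite -EFinD !abse_EFin lee_fin normr_id ger0_norm.
    by have := sqr_ge0 (`|Y i w| - 1); have := normr_ge0 (Y i w); nra.
  by rewrite addr_ge0// sqr_ge0.
- apply: integrableD => //; first exact: finite_measure_integrable_cst.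
  apply/integrableP; split.
    by apply/measurable_EFinP; apply: measurable_funX; exact: mV.
  under eq_integral do rewrite gee0_abs ?lee_fin ?sqr_ge0//.
  by rewrite eE ltry.
Qed.

Let mfY : measurable_fun [set: T] fY.
Proof. exact: measurableT_comp mf (measurable_rv_tuple Y). Qed.

Let ifY : P.-integrable [set: T] (fun w => (fY w)%:E).
Proof.
apply: (integrable_le_sum (C := 0) integrable_norm) => // w.
rewrite add0r; apply: le_trans (half_norm_sum_le _) _.
by under eq_bigr do rewrite tnth_mktuple.
Qed.

HB.instance Definition _ := isMeasurableFun.Build _ _ _ _ fY mfY.

(** The argument common to both bounds: tensorization, the truncated moment of each [|Y_i|], then
    [U2_le] and [tail_const_le] to express everything through [sigma^2]. *)
Lemma deviation_le (l eta kappa theta t x : R) : 0 < l ->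
  l * (K * z) + eta <= alpha * (4 * L) ->
  (forall s, 1 <= s -> s ^+ 3 <= kappa * expR (eta * (s - 1))) ->
  1 / 6 + 8 / 75 * kappa <= theta ->
  x <= l * t - l ^+ 2 * sigma ^+ 2 / 2 *
         (1 + theta * (l * (K * z) * expR (l * (K * z)))) ->
  ((1 - expR (- x))%:E <= P [set w | (fY w)%:E - 'E_P[fY] <= t%:E])%E.
Proof.
move=> l0; rewrite mulrA => a_le kappaP kappa_theta xt.
have kappa0 : 0 <= kappa.
  by have := kappaP _ (lexx 1); rewrite subrr mulr0 expR0 expr1n mulr1; lra.
have a0 : 0 <= l * K * z by rewrite !mulr_ge0 ?powR_ge0 ?(ltW K_gt0) ?(ltW l0).
have ifin := integrable_fin_num measurableT ifY.
have -> : ('E_P[fY] = (fine (\int[P]_w (fY w)%:E))%:E)%E by rewrite unlock fineK.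
apply: (chernoff_complement l0 _ xt).
have f_le y : `|f y| <= 0 + \sum_(i < n) `|tnth y i|.
  by rewrite add0r half_norm_sum_le.
have := mgf_tensor mnorm (ltW l0) integrable_norm iY mf f_le
  (@half_norm_sum_lipschitz _ _ E n).
move=> /le_trans; apply; apply: lee_wpmul2l; first by rewrite lee_fin expR_ge0.
have cosh_le i := cosh_moment_le alpha1 L_ge1 (ltW l0) K_gt0 a_le kappaP
  (mV i) (V0 i) (psiE i) (k_le i).
apply: le_trans (prode_le_expR _ cosh_le) _.
  by move=> i; apply: integral_ge0 => w _; rewrite lee_fin cosh_ge0.
rewrite lee_fin ler_expR -mulr_sumr -/z.
set ex := cosh_excess _; set tc := tail_const _ _ _ _ _.
have -> : \sum_(i < n) ((1 + ex) * e i + 2 * k i ^+ 2 * tc) =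
    (1 + ex) * sigma ^+ 2 + 2 * tc * U ^+ 2.
  rewrite big_split/= -mulr_sumr -sigmaE U2 mulr_sumr; congr (_ + _).
  by apply: eq_bigr => i _; rewrite mulrAC.
have tc0 : 0 <= tc by exact: (tail_const_ge0 alpha L_ge1 (ltW l0) K_gt0 kappaP).
have h1 := ler_wpM2l (mulr_ge0 (ler0n R 2) tc0) U2_le.
have h2 := ler_wpM2l (sqr_ge0 sigma) (tail_const_le L_ge1 kappa0 a0 kappa_theta).
rewrite -/z -/ex -/tc in h2.
have l20 : 0 <= l ^+ 2 / 2 by rewrite divr_ge0 ?sqr_ge0.
set rhs := 1 + theta * _ in h2 *.
have XY : (1 + ex) * sigma ^+ 2 + 2 * tc * U ^+ 2 <= sigma ^+ 2 * rhs.
  by move: h1 h2; lra.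
by have := ler_wpM2l l20 XY; lra.
Qed.

Let rho : R := n.+1%:R / n%:R.

Let rho_ge1 : 1 <= rho.
Proof. by rewrite ler_pdivlMr ?ltr0n// mul1r ler_nat. Qed.

Let b := K * z.

Let b_gt0 : 0 < b.
Proof. by rewrite mulr_gt0 ?powR_gt0// mulr_gt0//; exact: lt_le_trans L_ge1. Qed.

Let sqrt_rho x : 0 < x ->
  sigma * Num.sqrt (2 * x) <= sigma * Num.sqrt (2 * x * rho).
Proof.
move=> x0; rewrite ler_wpM2l ?(ltW sigma_gt0)// ler_wsqrtr// ler_peMr//.
by rewrite mulr_ge0// ltW.
Qed.

Lemma bernstein_deviation x t : 0 < x ->
  sigma * Num.sqrt (2 * x) + 3 / 4 * b * x <= t ->
  ((1 - expR (- x))%:E <= P [set w | (fY w)%:E - 'E_P[fY] <= t%:E])%E.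
Proof.
move=> x0 xt.
have [l [l0 lb lx]] := bernstein_choice sigma_gt0 b_gt0 x0.
(* As [a <= 4 / 3], [a + 8 / 3 <= 4 <= 4 alpha L]; and [1 / 6 + 16 / 75 <= 2 / 5]. *)
apply: (@deviation_le l (8 / 3) 2 (2 / 5)) => //.
- rewrite -/b; have : 4 <= alpha * (4 * L); last lra.
  by have := L_ge1; have := alpha1; nra.
- by move=> s; exact: cube_le_expR_small.
- by lra.
- rewrite -/b; apply: le_trans lx _.
  by rewrite lerD2r ler_wpM2l// ltW.
Qed.

Lemma bennett_deviation x t m : 0 < x -> 16 / 3 <= m ->
  m <= 2 * alpha * (4 * L) -> (sigma / b) ^+ 2 * expR m <= x ->
  4 * b * x / m <= t ->
  ((1 - expR (- x))%:E <= P [set w | (fY w)%:E - 'E_P[fY] <= t%:E])%E.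
Proof.
move=> x0 m16 mL mx xt.
have m0 : 0 < m by lra.
have lb : m / (3 * b) * b = m / 3 by field; rewrite gt_eqF.
have l0 : 0 < m / (3 * b) by rewrite divr_gt0// mulr_gt0.
(* Here [a = m / 3], and [m >= 16 / 3] gives [8 / 9 <= m / 6], so [a + 8 / 9 <= m / 2 <= 4 alpha L];
   and [1 / 6 + 56 / 75 <= 1]. *)
apply: (@deviation_le (m / (3 * b)) (8 / 9) 7 1) => //.
- by rewrite -/b lb; lra.
- by move=> s; exact: cube_le_expR_large.
- by lra.
- rewrite -/b lb; apply: le_trans (bennett_choice sigma_gt0 b_gt0 m16 mx) _.
  by rewrite lerD2r ler_wpM2l// ltW.
Qed.

Lemma concentration x : 0 < x ->
    ((1 - expR (- x))%:E <=
      P [set w | ((fY w)%:E - 'E_P[fY] <=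
        (sigma * Num.sqrt (2 * x * rho) +
         4 * K * z * x /
           Num.min (2 * alpha * z `^ alpha)
                   (logbar ((K * z / (sigma * rho)) ^+ 2 * x)))%:E)%E])%E
    /\
    ((1 - expR (- x))%:E <=
      P [set w | ((fY w)%:E - 'E_P[fY] <=
        (sigma * Num.sqrt (2 * x * rho) + 3 / 4 * K * z * x * rho)%:E)%E])%E.
Proof.
move=> x0; have sr := sqrt_rho x0.
have alpha0 : 0 < alpha by exact: lt_le_trans alpha1.
have L0 : 0 < L by exact: lt_le_trans L_ge1.
have zalpha : z `^ alpha = 4 * L.
  by rewrite /z -powRrM mulVf ?gt_eqF// powRr1// mulr_ge0// ltW.
split; last first.
  apply: bernstein_deviation => //; apply: lerD => //.
  have -> : 3 / 4 * K * z * x * rho = 3 / 4 * b * x * rho by rewrite /b !mulrA.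
  have bx0 : 0 < b * x by rewrite mulr_gt0.
  by apply: ler_peMr => //; lra.
rewrite zalpha; set m := Num.min _ _.
have -> : 4 * K * z = 4 * b by rewrite mulrA.
have m0 : 0 < m.
  rewrite lt_min mulr_gt0 ?mulr_gt0//=.
  by rewrite /logbar lt_max ltr01 orbT.
(* For [m <= 16 / 3] one has [4 / m >= 3 / 4], so the Bernstein bound is already stronger. *)
have [m16|/ltW m16] := leP m (16 / 3).
  apply: bernstein_deviation => //; apply: lerD => //.
  rewrite ler_pdivlMr//.
  have := ler_wpM2l (ltW (mulr_gt0 b_gt0 x0)) m16; lra.
apply: (@bennett_deviation _ _ m) => //.
- by rewrite ge_min lexx.
(* Since [m >= 16 / 3 > 1], the floor 1 in [logbar] is not the binding term, and exponentiating
   bounds [expR m]. *)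
- have mlog : m <= ln ((b / (sigma * rho)) ^+ 2 * x).
    have : m <= logbar ((b / (sigma * rho)) ^+ 2 * x).
      by rewrite ge_min lexx orbT.
    rewrite /logbar le_max => /orP[//|m1]; lra.
  have rho0 : 0 < rho by exact: lt_le_trans rho_ge1.
  have pos : 0 < (b / (sigma * rho)) ^+ 2 * x.
    by rewrite mulr_gt0// exprn_gt0// divr_gt0// mulr_gt0.
  have em : expR m <= (b / (sigma * rho)) ^+ 2 * x.
    by rewrite -[leRHS]lnK ?posrE// ler_expR.
  apply: (@le_trans _ _ ((sigma / b) ^+ 2 * ((b / (sigma * rho)) ^+ 2 * x))).
    by rewrite ler_wpM2l ?sqr_ge0.
  have -> : (sigma / b) ^+ 2 * ((b / (sigma * rho)) ^+ 2 * x) =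
      (rho ^+ 2)^-1 * x by field; rewrite !gt_eqF.
  by rewrite ler_piMl ?(ltW x0)// invf_le1 ?exprn_gt0// exprn_ege1.
(* In this regime the linear term alone suffices, and the nonnegative square-root term is
   dropped. *)
- by rewrite lerDr mulr_ge0 ?sqrtr_ge0// ltW.
Qed.

End concentration.

Theorem corollary3p7 (R : realType) (d dE : measure_display)
    (T : measurableType d) (P : probability T R)
    (E : measurableNormedModType dE R) (n : nat) (Y : 'I_n -> {RV P >-> E})
    (alpha : R) :
  let f : n.-tuple E -> R := @half_norm_sum dE R E n in
  1 <= alpha ->
  measurable_fun [set: E] (fun y : E => `|y|) ->
  measurable_fun [set: n.-tuple E] f ->
  mutually_independent Y ->
  (max_psi_norm alpha Y < +oo)%E ->
  (0 < l2_norm Y)%E ->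
  let K : R := fine (max_psi_norm alpha Y) in
  let U : R := fine (l2_psi_norm alpha Y) in
  let sigma : R := fine (l2_norm Y) in
  let z : R := (4 * logbar (expR 1 * U / sigma)) `^ alpha^-1 in
  let rho : R := n.+1%:R / n%:R in
  let fY : T -> R := fun w => f [tuple Y i w | i < n] in
  forall x : R, 0 < x ->
    ((1 - expR (- x))%:E <=
      P [set w | ((fY w)%:E - 'E_P[fY] <=
        (sigma * Num.sqrt (2 * x * rho) +
         4 * K * z * x /
           Num.min (2 * alpha * z `^ alpha)
                   (logbar ((K * z / (sigma * rho)) ^+ 2 * x)))%:E)%E])%E
    /\
    ((1 - expR (- x))%:E <=
      P [set w | ((fY w)%:E - 'E_P[fY] <=
        (sigma * Num.sqrt (2 * x * rho) + 3 / 4 * K * z * x * rho)%:E)%E])%E.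
Proof.
move=> f alpha1 mnorm mf iY Koo sigma0 K U sigma z rho fY x x0.
exact: concentration.
Qed.
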